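(* Let $X\in\mathbb R^{d\times n}$ and consider projection dimension $K=1$. Let $\{\mathbf u^k,\mathbf s^k\}$ be generated by PAMe (proximal alternating minimization with extrapolation) with parameters $\tau>0$, $\beta>0$, $\gamma\in[0,1)$: $$\mathbf s^{k+1}=\operatorname{sgn}(\tau\mathbf s^k+X^\top\mathbf e^k),\quad \mathbf u^{k+1}=\operatorname{PD}(\beta\mathbf u^k+X\mathbf s^{k+1}),\quad \mathbf e^{k+1}=\mathbf u^{k+1}-\gamma(\mathbf u^k-\mathbf u^{k+1}),$$ where $\mathbf u^0$ is chosen such that $\|X^\top\mathbf u^0\|_1\neq0$. If $\gamma,\tau,\beta$ are small enough, then after finitely many steps $\mathbf s^k$ will not change, and $X\mathbf s^k/\|X\mathbf s^k\|$ is a FOC point.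
   Context: PAMe is a method for the $L_1$-norm PCA problem, which for $K=1$ reads $\max_{\|\mathbf u\|=1}\|X^\top\mathbf u\|_1$; here $\mathbf u^k\in\mathbb R^d$ are unit vectors, $\mathbf s^k\in\mathbb R^n$ and $\mathbf e^k\in\mathbb R^d$. $\|\cdot\|$ is the Euclidean norm and $\|\cdot\|_1$ the $L_1$-norm. $\operatorname{sgn}(x)=x/|x|$ if $x\ne0$, $\operatorname{sgn}(0)=0$, applied entrywise. $\operatorname{PD}(\mathbf c)$ denotes the orthonormal factor of a polar decomposition of $\mathbf c$, i.e. a unit vector $\mathbf u$ with $\mathbf c=h\mathbf u$, $h\ge0$; for $\mathbf c\ne0$, $\operatorname{PD}(\mathbf c)=\mathbf c/\|\mathbf c\|$. $\partial\|\mathbf v\|_1\big|_{\mathbf v=X^\top\mathbf u}$ is the subdifferential of $\|\cdot\|_1$ at $X^\top\mathbf u$, i.e. the set of $\mathbf s\in\mathbb R^n$ with $s_i=\operatorname{sgn}((X^\top\mathbf u)_i)$ if $(X^\top\mathbf u)_i\neq0$ and $s_i\in[-1,1]$ otherwise. A unit vector $\mathbf u\in\mathbb R^d$ is a FOC (first-order optimality criteria) point if $\mathbf u=\operatorname{PD}(\mathbf w)$ for some $\mathbf w\in X\,\partial\|\mathbf v\|_1\big|_{\mathbf v=X^\top\mathbf u}$. *)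

(* Defs.v *)
From mathcomp Require Import all_boot all_order all_algebra.
From mathcomp Require Import classical_sets reals.

Set Implicit Arguments.
Unset Strict Implicit.
Unset Printing Implicit Defensive.

Import Order.TTheory GRing.Theory Num.Theory.

Local Open Scope classical_set_scope.
Local Open Scope ring_scope.

(* The norm `|v| that MathComp-Analysis puts on matrices is the sup norm. *)
Definition norm2 (R : realType) (m : nat) (v : 'cV[R]_m) : R :=
  Num.sqrt (\sum_(i < m) v i 0 ^+ 2).

Definition norm1 (R : realType) (m : nat) (v : 'cV[R]_m) : R :=
  \sum_(i < m) `|v i 0|.

Definition sgn (R : realType) (m : nat) (v : 'cV[R]_m) : 'cV[R]_m :=
  map_mx Num.sg v.

(* Read "u = PD(c)".  A relation, since the orthonormal factor of c = 0 is an
   arbitrary unit vector. *)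
Definition isPD (R : realType) (d : nat) (c u : 'cV[R]_d) : Prop :=
  norm2 u = 1 /\ exists2 h : R, 0 <= h & c = h *: u.

Definition subdiff_norm1 (R : realType) (n : nat) (v : 'cV[R]_n) :
    set 'cV[R]_n :=
  [set s | forall i : 'I_n,
     (v i 0 != 0 -> s i 0 = Num.sg (v i 0)) /\
     (v i 0 = 0 -> -1 <= s i 0 <= 1)].

Definition FOC (R : realType) (d n : nat) (X : 'M[R]_(d, n))
    (u : 'cV[R]_d) : Prop :=
  norm2 u = 1 /\
  exists2 w : 'cV[R]_d, [set X *m s | s in subdiff_norm1 (X^T *m u)] w
                      & isPD w u.

(* No condition is put on the values of u, s and e at index 0. *)
Definition PAMe (R : realType) (d n : nat) (X : 'M[R]_(d, n))
    (tau beta gamma : R) (u : nat -> 'cV[R]_d) (s : nat -> 'cV[R]_n)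
    (e : nat -> 'cV[R]_d) : Prop :=
  forall k : nat,
    [/\ s k.+1 = sgn (tau *: s k + X^T *m e k),
        isPD (beta *: u k + X *m s k.+1) (u k.+1)
      & e k.+1 = u k.+1 - gamma *: (u k - u k.+1)].

(* Main.v *)
(** For small parameters, [s k.+2 i] is the sign of the [i]-th entry of
    [X^T X (s k.+1)] whenever this entry is nonzero.  Hence [|X s|^2] is
    nondecreasing along the iteration, and stationary only where [X s] itself
    is; as [s] takes finitely many values, [X s] is eventually a constant [w],
    and [w / |w|] is a FOC point.  On a coordinate where [X^T w] vanishes,
    [X^T u] and hence [X^T e] decay geometrically, so that once they are below
    [tau] a nonzero sign is frozen by the proximal term; a zero sign either
    persists forever or becomes nonzero and is frozen. *)
Require Import Defs.
From mathcomp Require Import all_boot all_order all_algebra.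
From mathcomp Require Import classical_sets reals boolp.
From mathcomp Require Import ring lra.

Set Implicit Arguments.
Unset Strict Implicit.
Unset Printing Implicit Defensive.

Import Order.TTheory GRing.Theory Num.Theory.
Local Open Scope ring_scope.

(** * Finite sets of values and eventual behaviour of sequences *)

Lemma seq_nonzero_lbound (R : realFieldType) (rs : seq R) :
  exists2 m : R, 0 < m & forall r, r \in rs -> r != 0 -> m <= `|r|.
Proof.
elim: rs => [|a rs [m m0 IH]]; first by exists 1.
have [->|a0] := eqVneq a 0.
  exists m => // r; rewrite inE => /orP[/eqP ->|]; first by rewrite eqxx.
  exact: IH.
exists (Num.min m `|a|); first by rewrite lt_min m0 normr_gt0.
move=> r; rewrite inE ge_min => /orP[/eqP -> _|rin r0].
  by rewrite lexx orbT.
by rewrite IH.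
Qed.

(** Every strict increase of [q] lowers the number of entries of [rs] above the current value, so
    only finitely many increases occur. *)
Lemma nondecreasing_seq_valued_stationary (R : realFieldType) (rs : seq R)
    (q : nat -> R) :
  (forall k, q k \in rs) -> (forall k, q k <= q k.+1) ->
  exists N, forall k, (N <= k)%N -> q k = q N.
Proof.
move=> qin qS.
have qle : {homo q : i j / (i <= j)%N >-> i <= j}.
  by apply: homo_leq => // y x z; apply: le_trans.
suff H c K : (count (fun r => (q K < r)%R) rs <= c)%N ->
    exists N, forall k, (N <= k)%N -> q k = q N by exact: (H _ 0%N (leqnn _)).
elim: c K => [|c IH] K hc.
all: have [hK|/existsNP[k /not_implyP[Kk /eqP qk]]] :=
  pselect (forall k, (K <= k)%N -> q k = q K); first by exists K.
all: have lt : q K < q k by rewrite lt_neqAle eq_sym qk qle.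
  move: hc; rewrite leqn0 -[_ == _]negbK -lt0n -has_count => /hasP[].
  by exists (q k).
apply: (IH k); rewrite -ltnS; apply: leq_trans hc.
(* The entries above [q K] split at [q k]; the lower part contains [q k] itself, so the count drops
   by at least one. *)
have -> : count (fun r => q K < r) rs =
    (count (fun r => (q k < r)%R) rs + count (fun r => (q K < r <= q k)%R) rs)%N.
  rewrite -count_predUI [X in (_ + X)%N](_ : _ = 0%N) ?addn0.
    apply: eq_count => r /=; case: (ltP (q k) r) => [kr|//].
      by rewrite (lt_trans lt kr).
    by rewrite andbT.
  apply/eqP; rewrite -leqn0 leqNgt -has_count; apply/hasP => -[r _ /=].
  by case: ltP => //; rewrite andbF.
by rewrite -addn1 leq_add2l -has_count; apply/hasP; exists (q k); rewrite ?lt /=.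
Qed.

Lemma eventually_lt_geometric (R : archiRealFieldType) (a : nat -> R) (t : R) :
  0 < t -> (forall k, 2 * `|a k.+1| <= `|a k|) ->
  exists N, forall k, (N <= k)%N -> `|a k| < t.
Proof.
move=> t0 ha.
have hk k : `|a k| * (2 ^ k)%:R <= `|a 0%N|.
  elim: k => [|k IH]; first by rewrite expn0 mulr1.
  apply: le_trans IH; rewrite expnS natrM mulrA [_ * 2]mulrC.
  by rewrite ler_wpM2r.
(* With this bound, [|a 0| / t < N <= k < 2 ^ k]. *)
exists (Num.bound (`|a 0%N| / t)) => k Nk.
have /archi_boundP hN : 0 <= `|a 0%N| / t by rewrite divr_ge0 // ltW.
move: hN; rewrite ltr_pdivrMr // => hN.
have le2 : (Num.bound (`|a 0%N| / t))%:R <= (2 ^ k)%:R :> R.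
  by rewrite ler_nat (leq_trans Nk) // ltnW // ltn_expl.
rewrite -(@ltr_pM2r _ (2 ^ k)%:R) ?ltr0n ?expn_gt0 //.
apply: le_lt_trans (hk k) (lt_le_trans hN _).
by rewrite mulrC ler_wpM2l // ltW.
Qed.

Lemma eventually_forall_ord (n : nat) (P : 'I_n -> nat -> Prop) :
  (forall i, exists N, forall k, (N <= k)%N -> P i k) ->
  exists N, forall i k, (N <= k)%N -> P i k.
Proof.
move=> /choice[f hf]; exists (\max_i f i) => i k Nk.
by apply: hf; apply: leq_trans Nk; apply: (leq_bigmax i).
Qed.

(** * The Euclidean norm of column vectors *)

Section EuclideanColumns.
Variables (R : realType) (m : nat).
Implicit Type v : 'cV[R]_m.

Lemma norm2_eq1 v : norm2 v = 1 -> \sum_j v j 0 ^+ 2 = 1.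
Proof.
move=> h; rewrite -(expr1n _ 2) -h sqr_sqrtr //.
by apply: sumr_ge0 => j _; apply: sqr_ge0.
Qed.

Lemma norm2_eq1_coord_le1 v j : norm2 v = 1 -> `|v j 0| <= 1.
Proof.
move=> /norm2_eq1 h; rewrite -(@ler_pXn2r _ 2) ?nnegrE // expr1n -normrX.
rewrite ger0_norm ?sqr_ge0 // -h (bigD1 j) //= lerDl.
by apply: sumr_ge0 => i _; apply: sqr_ge0.
Qed.

Lemma norm2_gt0 v : v != 0 -> 0 < norm2 v.
Proof.
move=> v0; rewrite sqrtr_gt0 lt_neqAle sumr_ge0 ?andbT; last first.
  by move=> j _; apply: sqr_ge0.
apply: contra_neq v0 => /esym/psumr_eq0P h; apply/colP => j; rewrite mxE.
by apply/eqP; rewrite -sqrf_eq0 h // => i _; apply: sqr_ge0.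
Qed.

Lemma norm2Z a v : 0 <= a -> norm2 (a *: v) = a * norm2 v.
Proof.
move=> a0; rewrite /norm2 -[in RHS](ger0_norm a0) -sqrtr_sqr -sqrtrM ?sqr_ge0 //.
by congr Num.sqrt; rewrite mulr_sumr; apply: eq_bigr => j _; rewrite mxE exprMn.
Qed.

End EuclideanColumns.

(** The values 0, 1, 2 of ['I_3] are shifted to the signs -1, 0, 1. An explicit list makes the
    lemmas on finite lists of values applicable. *)
Definition sign_vectors (R : realType) (n : nat) : seq 'cV[R]_n :=
  [seq \col_i ((f i : nat)%:R - 1) | f : {ffun 'I_n -> 'I_3}].

Lemma sgn_sign_vectors (R : realType) (n : nat) (v : 'cV[R]_n) :
  sgn v \in sign_vectors R n.
Proof.
pose f := [ffun i => inord (if v i 0 == 0 then 1 else if v i 0 < 0 then 0 else 2)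
             : 'I_3].
apply/mapP; exists f; first by rewrite mem_enum.
apply/colP => i; rewrite !mxE ffunE.
by case: sgrP; rewrite inordK //; lra.
Qed.

(** * Ascent of [|X s|^2], FOC points, and bounds on the polar factor *)

Section GramStep.
Variables (R : realType) (d n : nat) (X : 'M[R]_(d, n)).
Implicit Types (s t : 'cV[R]_n) (u : 'cV[R]_d).

Lemma dot_mulmx s u :
  \sum_j (X *m s) j 0 * u j 0 = \sum_i s i 0 * (X^T *m u) i 0.
Proof.
transitivity ((s^T *m (X^T *m u)) 0 0).
  by rewrite mulmxA -trmx_mul [RHS]mxE; apply: eq_bigr => j _; rewrite [in RHS]mxE.
by rewrite [LHS]mxE; apply: eq_bigr => i _; rewrite [X in X * _]mxE.
Qed.

Lemma subdiff_dot s (v : 'cV[R]_n) :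
  subdiff_norm1 v s -> \sum_i s i 0 * v i 0 = norm1 v.
Proof.
move=> hs; apply: eq_bigr => i _; have [-> //|/(hs i).1 ->] := eqVneq (v i 0) 0.
  by rewrite mulr0 normr0.
by rewrite normrEsg.
Qed.

Let Q t := \sum_j (X *m t) j 0 ^+ 2.

(** On the cube [[-1, 1]^n], [t] maximizes the pairing with [X^T X s], so
    [<X t, X s> >= <X s, X s>]; inserting this into the expansion of [|X t - X s|^2] gives the
    bound. Both monotonicity and its equality case follow. *)
Lemma gram_step_dist s t :
  (forall i, `|s i 0| <= 1) -> subdiff_norm1 (X^T *m (X *m s)) t ->
  \sum_j ((X *m t) j 0 - (X *m s) j 0) ^+ 2 <= Q t - Q s.
Proof.
move=> s1 /subdiff_dot; rewrite -dot_mulmx => ht.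
have hs : Q s <= norm1 (X^T *m (X *m s)).
  rewrite /Q; under eq_bigr do rewrite expr2.
  rewrite dot_mulmx; apply: ler_sum => i _; apply: le_trans (ler_norm _) _.
  by rewrite normrM ler_piMl.
have -> : \sum_j ((X *m t) j 0 - (X *m s) j 0) ^+ 2 =
    Q t + Q s - 2 * \sum_j (X *m t) j 0 * (X *m s) j 0.
  rewrite /Q mulr_sumr -big_split -sumrB; apply: eq_bigr => j _ /=; ring.
rewrite ht; lra.
Qed.

Lemma gram_step_le s t :
  (forall i, `|s i 0| <= 1) -> subdiff_norm1 (X^T *m (X *m s)) t -> Q s <= Q t.
Proof.
move=> s1 /(gram_step_dist s1) h; rewrite -subr_ge0; apply: le_trans h.
by apply: sumr_ge0 => j _; apply: sqr_ge0.
Qed.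

Lemma gram_step_eq s t :
  (forall i, `|s i 0| <= 1) -> subdiff_norm1 (X^T *m (X *m s)) t ->
  Q t = Q s -> X *m t = X *m s.
Proof.
move=> s1 /(gram_step_dist s1) h e; move: h; rewrite e subrr => h.
have /eqP/psumr_eq0P H : \sum_j ((X *m t) j 0 - (X *m s) j 0) ^+ 2 == 0.
  by rewrite eq_le h sumr_ge0 // => j _; apply: sqr_ge0.
apply/colP => j; apply/eqP; rewrite -subr_eq0 -sqrf_eq0 H // => i _.
exact: sqr_ge0.
Qed.

(** The subdifferential depends only on the signs of [X^T u], so it is unchanged under positive
    scaling of [u]. *)
Lemma FOC_normalized s :
  X *m s != 0 -> subdiff_norm1 (X^T *m (X *m s)) s ->
  FOC X ((norm2 (X *m s))^-1 *: (X *m s)).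
Proof.
move=> /norm2_gt0 p hs.
have n1 : norm2 ((norm2 (X *m s))^-1 *: (X *m s)) = 1.
  by rewrite norm2Z ?invr_ge0 ?ltW // mulVf ?gt_eqF.
split=> //; exists (X *m s).
  exists s => // i; rewrite -scalemxAr mxE mulf_eq0 negb_or sgrM.
  have [h1 h2] := hs i.
  rewrite (gtr0_sg (_ : 0 < _^-1)) ?invr_gt0 // mul1r; split=> [/andP[_]//|].
  by move/eqP; rewrite mulf_eq0 invr_eq0 gt_eqF //= => /eqP.
split=> //; exists (norm2 (X *m s)); first exact: ltW.
by rewrite scalerA divff ?gt_eqF // scale1r.
Qed.

(** A single crude constant, bounding the entries of [X^T u] for unit [u] as well as the share of
    [X s] in the polar factor. *)
Definition abs_sum : R := \sum_j \sum_i `|X j i|.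

Lemma abs_sum_ge0 : 0 <= abs_sum.
Proof. by apply: sumr_ge0 => j _; apply: sumr_ge0. Qed.

Lemma trmx_mul_unit_le u i : norm2 u = 1 -> `|(X^T *m u) i 0| <= abs_sum.
Proof.
move=> hu; rewrite mxE; apply: le_trans (ler_norm_sum _ _ _) _.
apply: ler_sum => j _; rewrite mxE normrM.
apply: (@le_trans _ _ `|X j i|); first by rewrite ler_piMr ?norm2_eq1_coord_le1.
by rewrite (bigD1 i) //= lerDl sumr_ge0.
Qed.

(** Pairing the polar equation with the unit vector [u'] isolates [h]; the term [d] comes from
    bounding each entry of [beta u] by 1. *)
Lemma isPD_factor_le (beta h : R) s u u' :
  (forall i, `|s i 0| <= 1) -> 0 <= beta <= 1 ->
  norm2 u = 1 -> norm2 u' = 1 -> beta *: u + X *m s = h *: u' ->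
  h <= d%:R + abs_sum.
Proof.
move=> s1 /andP[b0 b1] hu hu' e.
have -> : h = \sum_j u' j 0 * (beta *: u + X *m s) j 0.
  rewrite e -[LHS]mulr1 -(norm2_eq1 hu') mulr_sumr.
  by apply: eq_bigr => j _; rewrite mxE; ring.
have -> : d%:R + abs_sum = \sum_(j < d) (1 + \sum_i `|X j i|).
  by rewrite big_split /= sumr_const card_ord.
apply: ler_sum => j _; apply: le_trans (ler_norm _) _; rewrite normrM !mxE.
apply: le_trans (ler_piMl (normr_ge0 _) (norm2_eq1_coord_le1 j hu')) _.
apply: le_trans (ler_normD _ _) (lerD _ _).
  by rewrite normrM mulr_ile1 ?norm2_eq1_coord_le1 // ger0_norm.
apply: le_trans (ler_norm_sum _ _ _) (ler_sum _ _) => i _.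
by rewrite normrM ler_piMr.
Qed.

(** At one coordinate where [X s] is nonzero, [m <= |h u'_j - beta u_j| <= h + beta]. *)
Lemma isPD_factor_ge (beta h m : R) s u u' :
  0 <= beta -> 0 <= h -> norm2 u = 1 -> norm2 u' = 1 ->
  beta *: u + X *m s = h *: u' -> X *m s != 0 ->
  (forall j, (X *m s) j 0 != 0 -> m <= `|(X *m s) j 0|) -> m - beta <= h.
Proof.
move=> b0 h0 hu hu' e w0 hm.
have [j wj] : exists j, (X *m s) j 0 != 0.
  apply/existsP; apply: contraNT w0; rewrite negb_exists => /forallP w0.
  by apply/eqP/colP => j; rewrite [RHS]mxE; apply/eqP; rewrite -[_ == _]negbK.
have := hm j wj; have /colP/(_ j) := e.
rewrite [LHS]mxE [in X in X + _]mxE [RHS]mxE => ej.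
have -> : (X *m s) j 0 = h * u' j 0 - beta * u j 0 by rewrite -ej; ring.
have := ler_normB (h * u' j 0) (beta * u j 0).
rewrite !normrM (ger0_norm b0) (ger0_norm h0).
have := ler_piMr h0 (norm2_eq1_coord_le1 j hu').
have := ler_piMr b0 (norm2_eq1_coord_le1 j hu).
lra.
Qed.

End GramStep.

(** * Scalar signs under perturbation and under the proximal recursion *)

Lemma sgr_perturb (R : realDomainType) (g err : R) :
  `|err| < `|g| -> Num.sg (g + err) = Num.sg g.
Proof.
have [g0|g0|->] := ltrgt0P g; last by rewrite normr_lt0.
  by rewrite ltr_norml => /andP[h1 h2]; rewrite !gtr0_sg //; lra.
by rewrite ltr_norml => /andP[h1 h2]; rewrite !ltr0_sg //; lra.
Qed.

Lemma sgr_prox_stationary (R : realDomainType) (tau : R) (x c : nat -> R)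
    (N : nat) :
  (forall k, x k.+1 = Num.sg (tau * x k + c k)) ->
  (forall k, (N <= k)%N -> `|c k| < tau) ->
  exists N', forall k, (N' <= k)%N -> x k.+1 = x k.
Proof.
move=> xS cN.
(* The inequality is strict because [x 0] is arbitrary: for [k > N], [x k] is itself a sign, so if
   nonzero it gives [|tau * x k| = tau > |c k|]. *)
have frozen k : (N < k)%N -> x k != 0 -> x k.+1 = x k.
  case: k => // k Nk x0; have ck := cN k.+1 (leqW Nk).
  have tau0 : 0 < tau by apply: le_lt_trans (normr_ge0 _) ck.
  have x1 : `|x k.+1| = 1.
    by move: x0; rewrite xS normr_sg sgr_eq0 => ->.
  rewrite xS sgr_perturb; first by rewrite sgrM gtr0_sg // mul1r xS sgr_id.
  by rewrite normrM x1 mulr1 (gtr0_norm tau0).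
have [x0|/existsNP[k0 /not_implyP[Nk0 /eqP x0]]] :=
  pselect (forall k, (N < k)%N -> x k = 0).
  by exists N.+1 => k Nk; rewrite !x0 // leqW.
exists k0 => k k0k; apply: (frozen); first exact: leq_trans k0k.
elim: k k0k => [|k IH]; first by rewrite leqn0 => /eqP <-.
rewrite leq_eqVlt => /orP[/eqP <- //|]; rewrite ltnS => k0k.
by rewrite frozen ?IH // (leq_trans Nk0).
Qed.

Lemma sgr_norm_le1 (R : realDomainType) (x : R) : `|Num.sg x| <= 1.
Proof. by rewrite normr_sg; case: eqP. Qed.

(** * A single PAMe step *)

Section Step.
Variables (R : realType) (d n : nat) (X : 'M[R]_(d, n)).
Variables (tau beta gamma : R).
Hypotheses (tau0 : 0 < tau) (beta0 : 0 < beta) (gamma01 : 0 <= gamma < 1).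

Lemma trmx_mul_extrapolated (u u' e' : 'cV[R]_d) i :
  e' = u' - gamma *: (u - u') ->
  (X^T *m e') i 0 =
    (1 + gamma) * (X^T *m u') i 0 - gamma * (X^T *m u) i 0.
Proof.
move=> ->; rewrite mulmxBr -scalemxAr mulmxBr.
move: (X^T *m u) (X^T *m u') => a a'; rewrite !mxE; ring.
Qed.

Lemma trmx_mul_isPD (u u' : 'cV[R]_d) s h i :
  beta *: u + X *m s = h *: u' ->
  h * (X^T *m u') i 0 = beta * (X^T *m u) i 0 + (X^T *m (X *m s)) i 0.
Proof.
move=> /(congr1 (fun v => (X^T *m v) i 0)).
rewrite mulmxDr -!scalemxAr.
move: (X^T *m u) (X^T *m u') (X^T *m (X *m s)) => a a' g.
by rewrite !mxE => ->.
Qed.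

(* Multiplying by the polar factor [h] avoids normalizing [X s]: the argument of
   the sign becomes [(1 + gamma) X^T X s] plus a small error. *)
Lemma PAMe_step_subdiff (m mu : R) (u u' e' : 'cV[R]_d) (s : 'cV[R]_n) :
  (forall i, `|s i 0| <= 1) -> norm2 u = 1 ->
  isPD (beta *: u + X *m s) u' -> e' = u' - gamma *: (u - u') ->
  X *m s != 0 ->
  (forall j, (X *m s) j 0 != 0 -> m <= `|(X *m s) j 0|) ->
  (forall i, (X^T *m (X *m s)) i 0 != 0 -> mu <= `|(X^T *m (X *m s)) i 0|) ->
  beta <= 1 -> beta < m ->
  (d%:R + abs_sum X) * tau
    + (2 * beta + gamma * (d%:R + abs_sum X)) * abs_sum X < mu ->
  subdiff_norm1 (X^T *m (X *m s)) (sgn (tau *: s + X^T *m e')).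
Proof.
move=> s1 hu [hu' [h h0 eh]] he w0 hm hmu b1 bm hsmall i.
have hle : h <= d%:R + abs_sum X.
  by apply: isPD_factor_le eh => //; rewrite ltW.
have hge := isPD_factor_ge (ltW beta0) h0 hu hu' eh w0 hm.
have hgt0 : 0 < h by apply: lt_le_trans hge; rewrite subr_gt0.
rewrite [sgn _ _ _]mxE [X in Num.sg X]mxE [X in X + _]mxE.
split=> [g0|_]; last by rewrite -ler_norml sgr_norm_le1.
rewrite (trmx_mul_extrapolated _ he).
have ea := trmx_mul_isPD i eh.
have a1 := trmx_mul_unit_le X i hu; have si := s1 i.
move: (hmu i g0) ea a1 si.
set g : R := (X^T *m (X *m s)) i 0; set a : R := (X^T *m u) i 0.
set a' : R := (X^T *m u') i 0; set x : R := s i 0 => hg ea a1 x1.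
have /andP[ga0 ga1] := gamma01.
rewrite -[LHS]mul1r -[X in X * _](gtr0_sg hgt0) -sgrM.
have -> : h * (tau * x + ((1 + gamma) * a' - gamma * a)) =
    (1 + gamma) * g + (h * tau * x + (1 + gamma) * beta * a - gamma * h * a).
  transitivity (h * tau * x + (1 + gamma) * (h * a') - gamma * h * a); first ring.
  by rewrite ea; ring.
rewrite sgr_perturb; first by rewrite sgrM gtr0_sg ?mul1r //; lra.
have c1 : 0 <= h * tau by rewrite mulr_ge0 // ltW.
have c2 : 0 <= (1 + gamma) * beta by rewrite mulr_ge0 ?addr_ge0 ?(ltW beta0).
have c3 : 0 <= gamma * h by rewrite mulr_ge0.
have B0 := abs_sum_ge0 X.
apply: le_lt_trans (ler_normB _ _) _.
(* The three errors come from the proximal term, from [beta u], and from the extrapolation; their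
   sum must stay below [mu <= |g| <= (1 + gamma) |g|]. *)
apply: (@le_lt_trans _ _ (h * tau + (1 + gamma) * beta * abs_sum X
                          + gamma * h * abs_sum X)).
  apply: lerD; last by rewrite normrM (ger0_norm c3) ler_wpM2l.
  apply: le_trans (ler_normD _ _) (lerD _ _).
    by rewrite normrM (ger0_norm c1) ler_piMr.
  by rewrite normrM (ger0_norm c2) ler_wpM2l.
apply: (@lt_le_trans _ _ mu); last first.
  apply: le_trans hg _; rewrite normrM ger0_norm; last lra.
  by rewrite ler_peMl //; lra.
apply: le_lt_trans hsmall.
have k1 : h * tau <= (d%:R + abs_sum X) * tau by rewrite ler_wpM2r // ltW.
have k2 : (1 + gamma) * beta * abs_sum X <= 2 * beta * abs_sum X.
  by rewrite ler_wpM2r // ler_wpM2r ?(ltW beta0) //; lra.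
have k3 : gamma * h * abs_sum X <= gamma * (d%:R + abs_sum X) * abs_sum X.
  by rewrite ler_wpM2r // ler_wpM2l.
lra.
Qed.

(** Where [X^T X s] vanishes, the polar equation reduces to [h a' = beta a] for the entries [a],
    [a'] of [X^T u], [X^T u'], and [h >= m - beta >= 2 beta]. *)
Lemma PAMe_step_contract (m : R) (u u' : 'cV[R]_d) (s : 'cV[R]_n) i :
  norm2 u = 1 -> isPD (beta *: u + X *m s) u' -> X *m s != 0 ->
  (forall j, (X *m s) j 0 != 0 -> m <= `|(X *m s) j 0|) -> 3 * beta <= m ->
  (X^T *m (X *m s)) i 0 = 0 ->
  2 * `|(X^T *m u') i 0| <= `|(X^T *m u) i 0|.
Proof.
move=> hu [hu' [h h0 eh]] w0 hm b3 g0.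
have hge := isPD_factor_ge (ltW beta0) h0 hu hu' eh w0 hm.
have := trmx_mul_isPD i eh; rewrite g0 addr0.
move=> /(congr1 Num.norm); rewrite !normrM (ger0_norm h0) (gtr0_norm beta0).
move=> ea; rewrite -(ler_pM2l beta0) -ea mulrA ler_wpM2r //; lra.
Qed.

(* If [X s^1 = 0], then [u^1 = u^0], and the next sign vector is driven by
   [X^T u^0 != 0]. *)
Lemma PAMe_step_escape (mu0 : R) (u u' e' : 'cV[R]_d) (s : 'cV[R]_n) :
  (forall i, `|s i 0| <= 1) -> norm2 u = 1 -> norm1 (X^T *m u) != 0 ->
  isPD (beta *: u + X *m s) u' -> e' = u' - gamma *: (u - u') ->
  X *m s = 0 ->
  (forall i, (X^T *m u) i 0 != 0 -> mu0 <= `|(X^T *m u) i 0|) ->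
  tau < mu0 -> X *m sgn (tau *: s + X^T *m e') != 0.
Proof.
move=> s1 hu n0 [hu' [h h0 eh]] he w0 hmu taumu.
move: eh; rewrite w0 addr0 => eh.
have bh : beta = h.
  by move/(congr1 (@norm2 R d)): (eh); rewrite (norm2Z _ (ltW beta0)) (norm2Z _ h0) hu hu' !mulr1.
have uu : u' = u by apply: (scalerI (lt0r_neq0 beta0)); rewrite eh bh.
move: he; rewrite uu subrr scaler0 subr0 => ->.
have /subdiff_dot : subdiff_norm1 (X^T *m u) (sgn (tau *: s + X^T *m u)).
  move=> i; rewrite [sgn _ _ _]mxE [X in Num.sg X]mxE [X in X + _]mxE.
  split=> [g0|_]; last by rewrite -ler_norml sgr_norm_le1.
  rewrite addrC sgr_perturb //; apply: lt_le_trans (hmu i g0).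
  by rewrite normrM (gtr0_norm tau0); apply: le_lt_trans taumu; rewrite ler_piMr ?(ltW tau0).
(* The pairing of [X t] with [u] equals [|X^T u|_1], so [X t = 0] would force the latter to
   vanish. *)
rewrite -dot_mulmx => e; apply: contra_neq n0 => t0.
by rewrite -e big1 // => j _; rewrite t0 mxE mul0r.
Qed.

End Step.

(** * Choice of the threshold and convergence of the iteration *)

Theorem theorem4p2 (R : realType) (d n : nat) (X : 'M[R]_(d, n))
    (u0 : 'cV[R]_d) (hu0 : norm2 u0 = 1) (hXu0 : norm1 (X^T *m u0) != 0) :
  exists2 eps : R, 0 < eps &
    forall (tau beta gamma : R),
      0 < tau -> 0 < beta -> 0 <= gamma < 1 ->
      tau < eps -> beta < eps -> gamma < eps ->
    forall (u : nat -> 'cV[R]_d) (s : nat -> 'cV[R]_n) (e : nat -> 'cV[R]_d),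
      u 0%N = u0 -> PAMe X tau beta gamma u s e ->
    exists N : nat, forall k : nat, (N <= k)%N ->
      s k = s N /\ FOC X ((norm2 (X *m s k))^-1 *: (X *m s k)).
Proof.
pose S := sign_vectors R n; pose Q (t : 'cV[R]_n) := \sum_j (X *m t) j 0 ^+ 2.
(* These gaps range over all sign vectors, so they depend only on [X] and [u0] and are fixed before
   the parameters. *)
have [m m0 hm] := seq_nonzero_lbound
  [seq (X *m t) j 0 | t <- S, j <- enum 'I_d].
have [mu muP hmu] := seq_nonzero_lbound
  [seq (X^T *m (X *m t)) i 0 | t <- S, i <- enum 'I_n].
have [mu0 mu0P hmu0] := seq_nonzero_lbound
  [seq (X^T *m u0) i 0 | i <- enum 'I_n].
pose B := abs_sum X; pose H := d%:R + B; pose C := H + (2 + H) * B + 1.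
have B0 : 0 <= B := abs_sum_ge0 X.
have H0 : 0 <= H by rewrite addr_ge0.
have HB0 : 0 <= (2 + H) * B by rewrite mulr_ge0 // addr_ge0.
have C0 : 0 < C by rewrite /C; lra.
(* [m / 3] serves the contraction, [mu0] the escape from [X s = 0], and [mu / C] the sign
   identification: if all parameters are below [r = mu / C], the total error is at most
   [(C - 1) r < mu]. *)
exists (Num.min (Num.min 1 (m / 3)) (Num.min mu0 (mu / C))).
  by rewrite !lt_min ltr01 mu0P !divr_gt0.
move=> tau beta gamma tau0 beta0 gamma01; rewrite !lt_min.
move=> /andP[_ /andP[tau_mu0 tau_mu]] /andP[/andP[beta1 beta_m] /andP[_ beta_mu]].
move=> /andP[_ /andP[_ gamma_mu]] u s e u0E P.
have {tau_mu beta_mu gamma_mu} small :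
    H * tau + (2 * beta + gamma * H) * B < mu.
  have eC : mu = mu / C * C by rewrite divfK ?gt_eqF.
  rewrite [X in _ < X]eC; have := divr_gt0 muP C0.
  move: (mu / C) tau_mu beta_mu gamma_mu => r rt rb rg r0.
  have k1 : H * tau <= H * r by rewrite ler_wpM2l // ltW.
  have k2 : (2 * beta + gamma * H) * B <= (2 * r + r * H) * B.
    by rewrite ler_wpM2r // lerD // ?ler_wpM2r // ?ler_wpM2l // ltW.
  rewrite /C; lra.
(* The shift discards [s 0], which need not be a sign vector. *)
pose t k := s k.+1.
have tS k : t k \in S by rewrite /t; have [-> _ _] := P k; apply: sgn_sign_vectors.
have t1 k i : `|t k i 0| <= 1.
  by rewrite /t; have [-> _ _] := P k; rewrite mxE sgr_norm_le1.
have un k : norm2 (u k) = 1 by case: k => [|k]; [rewrite u0E|have [_ [-> _] _] := P k].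
have upd k : isPD (beta *: u k + X *m t k) (u k.+1) by have [] := P k.
have ee k : e k.+1 = u k.+1 - gamma *: (u k - u k.+1) by have [] := P k.
have tE k : t k.+1 = sgn (tau *: t k + X^T *m e k.+1) by have [] := P k.+1.
have hmt k j : (X *m t k) j 0 != 0 -> m <= `|(X *m t k) j 0|.
  by apply: hm; apply: (allpairs_f (fun y i => (X *m y) i 0)); rewrite ?tS ?mem_enum.
have hmut k i : (X^T *m (X *m t k)) i 0 != 0 -> mu <= `|(X^T *m (X *m t k)) i 0|.
  by apply: hmu; apply: (allpairs_f (fun y i => (X^T *m (X *m y)) i 0)); rewrite ?tS ?mem_enum.
have step k : X *m t k != 0 -> subdiff_norm1 (X^T *m (X *m t k)) (t k.+1).
  move=> w0; rewrite tE.
  apply: (PAMe_step_subdiff tau0 beta0 gamma01 (t1 k) (un k) (upd k) (ee k) w0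
    (hmt k) (hmut k) (ltW beta1)) => //; lra.
(* As [s 0] and [e 0] are arbitrary, [X *m t 0] may vanish; then [X *m t 1] does not. *)
have [K0 wK0] : exists K0, X *m t K0 != 0.
  have [w0|w0] := eqVneq (X *m t 0%N) 0; last by exists 0%N.
  exists 1%N; rewrite tE.
  apply: (PAMe_step_escape tau0 beta0 (t1 _) (un _) _ (upd _) (ee _) w0 _ tau_mu0).
    by rewrite u0E.
  by move=> i; rewrite u0E; apply: hmu0; apply: map_f; rewrite mem_enum.
have Qgt0 k : X *m t k != 0 -> 0 < Q (t k).
  by move=> /norm2_gt0; rewrite sqrtr_gt0.
have w0 k : X *m t (K0 + k)%N != 0.
  elim: k => [|k IH]; first by rewrite addn0.
  have := gram_step_le (t1 _) (step _ IH); rewrite addnS leNgt.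
  apply: contraNneq => w; apply: le_lt_trans (Qgt0 _ IH).
  by rewrite big1 // => j _; rewrite w mxE expr0n.
have [N1 hN1] : exists N, forall k, (N <= k)%N -> Q (t (K0 + k)%N) = Q (t (K0 + N)%N).
  apply: (@nondecreasing_seq_valued_stationary _ [seq Q y | y <- S]) => k.
    exact: map_f.
  by rewrite addnS; apply: gram_step_le (t1 _) (step _ (w0 k)).
pose K := (K0 + N1)%N; pose w := X *m t K.
have wE k : X *m t (K + k)%N = w.
  elim: k => [|k IH]; first by rewrite addn0.
  rewrite addnS -IH; apply: gram_step_eq (t1 _) (step _ _) _.
    by rewrite -addnA w0.
  by rewrite -/(Q _) -/(Q _) -addnS -!addnA !hN1 // leq_addr.
have wn0 : w != 0 by rewrite /w w0.
have subd k : subdiff_norm1 (X^T *m w) (t (K + k).+1).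
  by rewrite -(wE k); apply: step; rewrite wE.
have [N2 hN2] : exists N, forall i k, (N <= k)%N ->
    t (K + k.+1)%N i 0 = t (K + k)%N i 0.
  apply: eventually_forall_ord => i.
  have [g0|g0] := eqVneq ((X^T *m w) i 0) 0; last first.
    (* The sign is prescribed only from [t K.+1] on, hence the start at 1. *)
    by exists 1%N => -[//|k] _; rewrite addnS (subd k.+1 i).1 // addnS (subd k i).1.
  have contr k : 2 * `|(X^T *m u (K + k.+1)%N) i 0| <= `|(X^T *m u (K + k)%N) i 0|.
    rewrite addnS; apply: (PAMe_step_contract beta0 (un _) (upd _) _ (hmt _)).
    - by rewrite wE.
    - lra.
    - by rewrite wE.
  (* With threshold [tau / 4], the entry of [X^T e] is at most [2 |a'| + |a| < 3 tau / 4]. *)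
  have [|N hN] := @eventually_lt_geometric _
    (fun k => (X^T *m u (K + k)%N) i 0) (tau / 4) _ contr; first by rewrite divr_gt0.
  apply: (@sgr_prox_stationary _ tau (fun k => t (K + k)%N i 0)
    (fun k => (X^T *m e (K + k).+1) i 0) N) => [k|k Nk].
    by rewrite addnS tE !mxE.
  rewrite (trmx_mul_extrapolated X i (ee _)).
  have /andP[ga0 ga1] := gamma01.
  have := hN k Nk; have := hN k.+1 (leqW Nk); rewrite addnS.
  move: (_ i 0) ((X^T *m u (K + k)%N) i 0) => a' a h' h.
  apply: le_lt_trans (ler_normB _ _) _.
  rewrite !normrM (ger0_norm ga0) ger0_norm; last lra.
  have := ler_piMl (normr_ge0 a) (ltW ga1).
  have := ler_piMl (normr_ge0 a') (ltW ga1); lra.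
(* The successor puts [t N] in the range of [subd], which the FOC claim needs. *)
pose N := (K + N2.+1)%N.
have tN k : (N <= k)%N -> t k = t N.
  move=> /subnKC <-; elim: (k - N)%N => [|j IH]; first by rewrite addn0.
  rewrite -IH; apply/colP => i.
  by rewrite /N -!(addnA K) !addSn (addnS N2) hN2 // leqW // leq_addr.
exists N.+1 => -[//|k] Nk; rewrite -/(t _) -/(t _) tN //; split=> //.
have wN : X *m t N = w by rewrite wE.
apply: FOC_normalized; first by rewrite wN.
by rewrite wN /N addnS; apply: subd.
Qed.
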